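(* Let $\Gamma_1$ and $\Gamma_2$ be finite simplicial graphs with the same $f$-polynomial, such that $|\mathrm{Lk}(\sigma)|=|\mathrm{Lk}(\sigma')|$ for all $\sigma\in\mathcal{A}(\Gamma_1)$ and $\sigma'\in\mathcal{A}(\Gamma_2)$ with $|\sigma|=|\sigma'|$. Then the right-angled Coxeter groups $G_1$ and $G_2$ based on $\Gamma_1$ and $\Gamma_2$, with their standard generating sets $V\Gamma_1$ and $V\Gamma_2$, have the same geodesic growth, i.e. $\mathcal{G}_{(G_1,V\Gamma_1)}(z)=\mathcal{G}_{(G_2,V\Gamma_2)}(z)$.
   Context: For a finite simplicial graph $\Gamma$ with vertex set $V\Gamma$ and edge set $E\Gamma$, $\mathcal{A}(\Gamma)$ is the set of non-empty subsets $\sigma\subseteq V\Gamma$ whose vertices span a complete subgraph (clique); the size of $\sigma$ is $|\sigma|$. For $\sigma\in\mathcal{A}(\Gamma)$, $\mathrm{Lk}(\sigma)=\{v\in V\Gamma\setminus\sigma : \{v\}\cup\sigma\in\mathcal{A}(\Gamma)\}$. The $f$-polynomial of $\Gamma$ is $f(t)=1+f_0t+f_1t^2+\cdots$, where $f_i$ is the number of cliques of size $i+1$ in $\Gamma$. The right-angled Coxeter group based on $\Gamma$ is $\langle s\in V\Gamma \mid s^2=1\ \forall s\in V\Gamma,\ (ss')^2=1\ \forall \{s,s'\}\in E\Gamma\rangle$. For a group $G$ generated by a finite set $S$, with natural projection $\pi\colon S^*\to G$ from the free monoid and word length $|\cdot|$ on $G$, the geodesic growth function is $\gamma_{(G,S)}(r)=|\{w\in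 S^*: |w|=|\pi(w)|=r\}|$ and the geodesic growth series is $\mathcal{G}_{(G,S)}(z)=\sum_{i\ge 0}\gamma_{(G,S)}(i)z^i$. *)

(* Defs.v *)
From HB Require Import structures.
From mathcomp Require Import all_boot all_order all_algebra.
From mathcomp Require Import boolp.

Set Implicit Arguments.
Unset Strict Implicit.
Unset Printing Implicit Defensive.

Import GRing.Theory.

Record sgraph := SGraph {
  vertex :> finType;
  adj : rel vertex;
  adj_sym : symmetric adj;
  adj_irr : irreflexive adj
}.

Section Cliques.
Variable Gamma : sgraph.
Implicit Types sigma : {set Gamma}.

Definition is_clique sigma : bool :=
  (sigma != set0) &&
  [forall x in sigma, forall y in sigma, (x != y) ==> adj x y].

Definition cliques : {set {set Gamma}} := [set sigma | is_clique sigma].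

Definition link sigma : {set Gamma} :=
  [set v | (v \notin sigma) && ((v |: sigma) \in cliques)].

Definition fnum (i : nat) : nat :=
  #|[set sigma in cliques | #|sigma| == i.+1]|.

(* The sum stops at #|Gamma| because no clique has more than #|Gamma|
   elements. *)
Definition fpoly : {poly int} :=
  (1 + \sum_(i < #|Gamma|) (fnum i)%:R *: 'X^(i.+1))%R.

End Cliques.

Section Presentation.
Variables (S : choiceType) (relator : seq (S * bool) -> Prop).

(* A letter (s, false) stands for s and (s, true) for the inverse of s. *)
Definition inv_letter (a : S * bool) : S * bool := (a.1, ~~ a.2).

Definition inv_word (w : seq (S * bool)) : seq (S * bool) :=
  rev (map inv_letter w).

Inductive pres_equiv : seq (S * bool) -> seq (S * bool) -> Prop :=
| pres_refl w : pres_equiv w w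
| pres_sym w1 w2 : pres_equiv w1 w2 -> pres_equiv w2 w1
| pres_trans w1 w2 w3 :
    pres_equiv w1 w2 -> pres_equiv w2 w3 -> pres_equiv w1 w3
| pres_cancel u v a : pres_equiv (u ++ [:: a; inv_letter a] ++ v) (u ++ v)
| pres_relator u v r : relator r -> pres_equiv (u ++ r ++ v) (u ++ v).

Definition pres_rel : rel (seq (S * bool)) := fun w1 w2 => `[< pres_equiv w1 w2 >].

Lemma pres_rel_refl : reflexive pres_rel.
Proof. by move=> w; apply/asboolP; apply: pres_refl. Qed.

Lemma pres_rel_sym : symmetric pres_rel.
Proof. by move=> w1 w2; apply/asboolP/asboolP; apply: pres_sym. Qed.

Lemma pres_rel_trans : transitive pres_rel.
Proof.
move=> w2 w1 w3 /asboolP h12 /asboolP h23.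
by apply/asboolP; apply: pres_trans h12 h23.
Qed.

Canonical pres_equiv_rel :=
  EquivRel pres_rel pres_rel_refl pres_rel_sym pres_rel_trans.

Local Open Scope quotient_scope.

Definition presented : Type := {eq_quot pres_rel}.
HB.instance Definition _ := Choice.on presented.
HB.instance Definition _ := EqQuotient.on presented.

Definition pres_class (w : seq (S * bool)) : presented := \pi_presented w.

Lemma pres_classP w1 w2 : pres_class w1 = pres_class w2 <-> pres_equiv w1 w2.
Proof.
split=> [/eqP | h]; first by rewrite eqmodE => /asboolP.
by apply/eqP; rewrite eqmodE; apply/asboolP.
Qed.

Lemma pres_class_repr (x : presented) : pres_class (repr x) = x.
Proof. exact: reprK. Qed.

Lemma pres_classW (P : presented -> Prop) :
  (forall w, P (pres_class w)) -> forall x, P x.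
Proof. by move=> h x; rewrite -[x]pres_class_repr. Qed.

Lemma pres_equiv_cat u1 u2 v1 v2 :
  pres_equiv u1 u2 -> pres_equiv v1 v2 -> pres_equiv (u1 ++ v1) (u2 ++ v2).
Proof.
move=> hu hv; apply: (@pres_trans _ (u2 ++ v1)).
  elim: hu => {u1 u2} [w | w1 w2 _ | w1 w2 w3 _ h12 _ | u v a | u v r hr].
  - exact: pres_refl.
  - exact: pres_sym.
  - exact: pres_trans h12.
  - by rewrite -!catA; apply: pres_cancel.
  - by rewrite -!catA; apply: pres_relator.
elim: hv => {v1 v2} [w | w1 w2 _ | w1 w2 w3 _ h12 _ | u v a | u v r hr].
- exact: pres_refl.
- exact: pres_sym.
- exact: pres_trans h12.
- by rewrite !(catA u2); apply: pres_cancel.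
- by rewrite !(catA u2); apply: pres_relator.
Qed.

Lemma inv_letterK : involutive inv_letter.
Proof. by case=> s b; rewrite /inv_letter /= negbK. Qed.

Lemma inv_wordK : involutive inv_word.
Proof. by move=> w; rewrite /inv_word map_rev revK (mapK inv_letterK). Qed.

Lemma pres_mulwV w : pres_equiv (w ++ inv_word w) [::].
Proof.
elim: w => [|a w IH]; first exact: pres_refl.
rewrite /inv_word map_cons rev_cons -cats1 -/(inv_word w) cat_cons catA.
apply: pres_trans (pres_cancel [::] [::] a).
rewrite -[_ :: _]cat1s /=; rewrite -[X in pres_equiv _ X]cat1s.
apply: (@pres_equiv_cat [:: a] [:: a]); first exact: pres_refl.
exact: (@pres_equiv_cat _ [::] _ [:: inv_letter a] IH (pres_refl _)).
Qed.

Lemma pres_mulVw w : pres_equiv (inv_word w ++ w) [::].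
Proof. by rewrite -{2}[w]inv_wordK; apply: pres_mulwV. Qed.

Lemma pres_equiv_inv w1 w2 :
  pres_equiv w1 w2 -> pres_equiv (inv_word w1) (inv_word w2).
Proof.
move=> h; apply: (@pres_trans _ (inv_word w1 ++ (w2 ++ inv_word w2))).
  rewrite -{1}[inv_word w1]cats0; apply: pres_equiv_cat; first exact: pres_refl.
  exact/pres_sym/pres_mulwV.
rewrite catA -{2}[inv_word w2]cat0s; apply: pres_equiv_cat (pres_refl _).
apply: pres_trans (pres_mulVw w1).
by apply: pres_equiv_cat; [apply: pres_refl | apply: pres_sym].
Qed.

Definition pres_one : presented := pres_class [::].
Definition pres_mul (x y : presented) : presented :=
  pres_class (repr x ++ repr y).
Definition pres_inv (x : presented) : presented :=
  pres_class (inv_word (repr x)).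

Lemma pres_repr w : pres_equiv (repr (pres_class w)) w.
Proof. by apply/pres_classP; rewrite pres_class_repr. Qed.

Lemma pres_mulE u v :
  pres_mul (pres_class u) (pres_class v) = pres_class (u ++ v).
Proof. by apply/pres_classP/pres_equiv_cat; apply: pres_repr. Qed.

Lemma pres_invE u : pres_inv (pres_class u) = pres_class (inv_word u).
Proof. by apply/pres_classP/pres_equiv_inv/pres_repr. Qed.

Lemma pres_mulA : associative pres_mul.
Proof.
elim/pres_classW=> u; elim/pres_classW=> v; elim/pres_classW=> w.
by rewrite !pres_mulE catA.
Qed.

Lemma pres_mul1 : left_id pres_one pres_mul.
Proof. by elim/pres_classW=> u; rewrite pres_mulE. Qed.

Lemma pres_mulr1 : right_id pres_one pres_mul.
Proof. by elim/pres_classW=> u; rewrite pres_mulE cats0. Qed.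

Lemma pres_mulV : left_inverse pres_one pres_inv pres_mul.
Proof.
by elim/pres_classW=> u; rewrite pres_invE pres_mulE; apply/pres_classP/pres_mulVw.
Qed.

Lemma pres_mulrV : right_inverse pres_one pres_inv pres_mul.
Proof.
by elim/pres_classW=> u; rewrite pres_invE pres_mulE; apply/pres_classP/pres_mulwV.
Qed.

HB.instance Definition _ := isGroup.Build presented
  pres_mulA pres_mul1 pres_mulr1 pres_mulV pres_mulrV.

Definition pres_gen (s : S) : presented := pres_class [:: (s, false)].

End Presentation.

Section GeodesicGrowth.
Variables (G : groupType) (S : finType) (gen : S -> G).

Definition word_eval (w : seq S) : G := \big[*%g/1%g]_(s <- w) gen s.

(* Lengths are taken with respect to words over S, without formal inverses:
   S is assumed to generate G as a monoid, as any set of involutions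
   generating G does. *)
Definition has_word_of_length (g : G) (n : nat) : bool :=
  `[< exists2 w : seq S, size w = n & word_eval w = g >].

(* The value 0 in the second branch is only used for elements outside the
   submonoid generated by S. *)
Definition word_length (g : G) : nat :=
  match pselect (exists n, has_word_of_length g n) with
  | left ex_word => ex_minn ex_word
  | right _ => 0
  end.

Definition geodesic_growth (r : nat) : nat :=
  #|[set w : r.-tuple S | word_length (word_eval w) == r]|.

(* A formal power series is represented by its sequence of coefficients. *)
Definition geodesic_growth_series : nat -> int :=
  fun i => ((geodesic_growth i)%:Z)%R.

End GeodesicGrowth.

Section RACG.
Variable Gamma : sgraph.

Inductive racg_relator : seq (Gamma * bool) -> Prop :=
| racg_involution (s : Gamma) :
    racg_relator [:: (s, false); (s, false)]
| racg_commute (s t : Gamma) : adj s t ->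
    racg_relator [:: (s, false); (t, false); (s, false); (t, false)].

Definition racg : groupType := presented racg_relator.

Definition racg_gen : Gamma -> racg := @pres_gen Gamma racg_relator.

End RACG.

(* Main.v *)
Require Import Defs.
From mathcomp Require Import all_boot all_order all_algebra.
From mathcomp Require Import boolp.

(** A word in a right-angled Coxeter group is geodesic exactly when no letter
    occurs twice with only letters commuting with it in between
    ([geodesic_reduced]). This follows from letting the group act on such reduced
    words, taken up to swaps of adjacent commuting letters: a generator [s]
    cancels an [s] that can be shuffled to the front, and otherwise is added in
    front. The defining relations hold for these operators ([lmulK],
    [lmul_comm]), so the result of applying a word to the empty word depends, up
    to swaps, only on the group element.

    Call descents the letters that can be shuffled to the front. They form a
    complete set [sigma], and a letter [v] may be added to the word exactly when
    [v] is not in [sigma]; the new set of descents consists of [v] and the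
    neighbours of [v] in [sigma]. Geodesics are thus the words accepted by an
    automaton whose states are the complete sets, including the empty one
    ([geodesic_growth_runs]).

    It remains to see that the number of runs of given length from a state
    depends only on the size of the state, in the same way for both graphs. By
    induction on the length it is enough that, for each [d], the number of
    vertices outside [sigma] with exactly [d] neighbours in [sigma] depends only
    on the size of [sigma]. For a subset [tau] of [sigma], the vertices outside
    [sigma] adjacent to all of [tau] are those of the link of [tau] outside
    [sigma :\: tau], so their number is given by the sizes of [sigma], [tau] and
    the link of [tau]. Summing over all [tau] of size [i] gives the sum of the
    binomials ['C(d, i)] over these vertices ([binomial_moments]), and these sums
    for all [i] determine the distribution of [d] ([eq_fibers]). The link of the
    empty set is the whole vertex set, and its size is a coefficient of the
    f-polynomial. *)

Set Implicit Arguments.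
Unset Strict Implicit.
Unset Printing Implicit Defensive.

Import GRing.Theory Num.Theory.

(** * Words up to commutation and the action of the Coxeter group *)

Section Traces.
Variable Gamma : sgraph.
Implicit Types (s t x : Gamma) (w : seq Gamma).

(** Equality in the right-angled Artin monoid, where adjacent letters commute:
    a word up to commutation is determined by its projections to pairs of
    non-commuting letters. With this encoding transitivity, congruence and left
    cancellation are immediate, and so is the counting of letters, since the
    pair [(s, s)] is among those allowed. *)
Definition same_trace w1 w2 : Prop :=
  forall s t, ~~ adj s t -> filter (pred2 s t) w1 = filter (pred2 s t) w2.

(** If commutations can bring an [s] to the front of [w], this is the rest of the
    word: the [s] in question can only be the first one, and all letters before
    it must commute with it. *)
Fixpoint extract s w : option (seq Gamma) :=
  if w is x :: w' then
    if x == s then Some w'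
    else if adj s x then omap (cons x) (extract s w') else None
  else None.

Definition descents w : {set Gamma} := [set s | isSome (extract s w)].

(** Left multiplication by [s] in the Coxeter group, computed on reduced words. *)
Definition lmul s w : seq Gamma := odflt (s :: w) (extract s w).

Fixpoint reduced w : bool :=
  if w is s :: w' then (s \notin descents w') && reduced w' else true.

Lemma same_trace_sym w1 w2 : same_trace w1 w2 -> same_trace w2 w1.
Proof. by move=> h s t /h. Qed.

Lemma same_trace_trans w2 w1 w3 :
  same_trace w1 w2 -> same_trace w2 w3 -> same_trace w1 w3.
Proof. by move=> h12 h23 s t st; rewrite h12 ?h23. Qed.

Lemma same_trace_cons x w1 w2 :
  same_trace (x :: w1) (x :: w2) <-> same_trace w1 w2.
Proof.
split=> h s t st; have := h s t st => /=; last by move=> ->.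
by case: ifP => // _ [].
Qed.

Lemma same_trace_swap s t w :
  adj s t -> same_trace (s :: t :: w) (t :: s :: w).
Proof.
move=> st x y xy /=.
case: (boolP ((s == x) || (s == y))) => // s_xy.
case: (boolP ((t == x) || (t == y))) => // t_xy.
case/orP: s_xy => /eqP e1; case/orP: t_xy => /eqP e2; subst=> //.
  by rewrite st in xy.
by rewrite adj_sym st in xy.
Qed.

Lemma same_trace_size w1 w2 : same_trace w1 w2 -> size w1 = size w2.
Proof.
move=> h; apply: perm_size; apply/allP=> x _ /=; apply/eqP.
have := congr1 size (h x x (negbT (adj_irr x))).
rewrite !size_filter; congr (_ = _); by apply: eq_count => y /=; rewrite orbb.
Qed.

Lemma extract_trace s w w' :
  extract s w = Some w' -> same_trace w (s :: w').
Proof.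
elim: w w' => //= x w IH w'; case: eqP => [-> [->] //|_].
case: ifP => // sx; case e: (extract s w) => [w1|] //= [<-].
apply: (same_trace_trans (w2 := x :: s :: w1)).
  by apply/same_trace_cons/IH.
by apply: same_trace_swap; rewrite adj_sym.
Qed.

(** The right-hand side only looks at the projections of [w], so that being a
    descent is invariant under commutations. *)
Lemma descentsP s w :
  reflect (forall t, ~~ adj s t -> ohead (filter (pred2 s t) w) = Some s)
          (s \in descents w).
Proof.
rewrite inE; elim: w => [|x w IH] /=.
  by constructor=> /(_ s (negbT (adj_irr s))).
case: eqP => [->|/eqP xs]; first by constructor.
case sx: (adj s x); last first.
  constructor=> /(_ x (negbT sx)); rewrite /= eqxx => -[/eqP].
  by rewrite (negPf xs).
case: (extract s w) IH => [w'|] /= IH; constructor.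
- move=> t st; case: eqP => [e|_]; first by rewrite -e sx in st.
  exact: (elimT IH).
- move=> h; apply: (elimF IH) => // t st; have := h t st.
  by case: eqP => [e|_] //; rewrite -e sx in st.
Qed.

Lemma same_trace_descents w1 w2 :
  same_trace w1 w2 -> descents w1 = descents w2.
Proof.
move=> h; apply/setP=> s.
by apply/descentsP/descentsP => d t st; move: (d t st); rewrite h.
Qed.

Lemma in_descents_cons s x w :
  (s \in descents (x :: w)) = (s == x) || (s \in descents w) && adj x s.
Proof.
rewrite !inE /= [s == x]eq_sym (adj_sym x s).
by case: (x == s); case: (adj s x); case: (extract s w).
Qed.

Lemma lmul_descent s w : s \in descents w -> same_trace w (s :: lmul s w).
Proof.
rewrite inE /lmul; case e: (extract s w) => [w'|] // _; exact: extract_trace.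
Qed.

Lemma lmul_new s w : s \notin descents w -> lmul s w = s :: w.
Proof. by rewrite inE /lmul; case: (extract s w). Qed.

Lemma same_trace_lmul s w1 w2 :
  same_trace w1 w2 -> same_trace (lmul s w1) (lmul s w2).
Proof.
move=> h; have e := same_trace_descents h.
have [d1|d1] := boolP (s \in descents w1); last first.
  by rewrite !lmul_new -?e //; apply/same_trace_cons.
apply/(same_trace_cons s); apply: same_trace_trans (lmul_descent _); last first.
  by rewrite -e.
exact: same_trace_trans (same_trace_sym (lmul_descent d1)) h.
Qed.

(** In a reduced word two occurrences of [s] are separated by a letter that does
    not commute with [s], hence after the removal of an initial [s] the next one
    cannot reach the front. *)
Lemma reduced_extract s w w' :
  reduced w -> extract s w = Some w' -> reduced w' /\ s \notin descents w'.
Proof.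
elim: w w' => //= x w IH w' /andP[xw rw]; case: eqP => [<- [<-] //|/eqP xs].
case: ifP => // sx; case e: (extract s w) => [w1|] //= [<-] /=.
have [rw1 sw1] := IH _ rw e; split.
  rewrite rw1 andbT; apply: contraNN xw.
  rewrite (same_trace_descents (extract_trace e)) in_descents_cons sx andbT => ->.
  by rewrite orbT.
by rewrite in_descents_cons (negPf sw1) eq_sym (negPf xs).
Qed.

Lemma reduced_lmul s w : reduced w -> reduced (lmul s w).
Proof.
move=> rw; have [|sw] := boolP (s \in descents w); last first.
  by rewrite lmul_new //= sw.
rewrite inE /lmul; case e: (extract s w) => [w'|] // _.
by have [] := reduced_extract rw e.
Qed.

(** The relator [s s] acts trivially. Reducedness matters: applied twice to
    the word [s s], the operation [lmul s] erases both letters. *)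
Lemma lmulK s w : reduced w -> same_trace (lmul s (lmul s w)) w.
Proof.
move=> rw; have [sw|sw] := boolP (s \in descents w); last first.
  by rewrite (lmul_new sw) /lmul /= eqxx.
have d := lmul_descent sw.
suff ns : s \notin descents (lmul s w).
  by rewrite (lmul_new ns); apply: same_trace_sym.
move: sw; rewrite inE /lmul; case e: (extract s w) => [w'|] // _.
by have [] := reduced_extract rw e.
Qed.

Lemma descents_lmul s t w :
  adj s t -> (s \in descents (lmul t w)) = (s \in descents w).
Proof.
move=> st; have ts: adj t s by rewrite adj_sym.
have nst : s == t = false by apply: contraTF st => /eqP ->; rewrite adj_irr.
have [tw|tw] := boolP (t \in descents w).
  rewrite (same_trace_descents (lmul_descent tw)).
  by rewrite in_descents_cons nst ts andbT.
by rewrite lmul_new // in_descents_cons nst ts andbT.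
Qed.

(** The commutation relators act trivially: multiplying by [t] does not change
    whether an adjacent [s] is a descent, so in each of the four cases the two
    orders add or remove the same letters. *)
Lemma lmul_comm s t w :
  adj s t -> same_trace (lmul s (lmul t w)) (lmul t (lmul s w)).
Proof.
move=> st; have ts: adj t s by rewrite adj_sym.
have nst : s != t by apply: contraTneq st => ->; rewrite adj_irr.
have dst := descents_lmul w st; have dts := descents_lmul w ts.
(* The mixed cases are symmetric in [s] and [t]. *)
have new_descent x y : adj x y -> x \in descents w -> y \notin descents w ->
    same_trace (lmul x (lmul y w)) (lmul y (lmul x w)).
  move=> xy xw yw; have yx: adj y x by rewrite adj_sym.
  rewrite (lmul_new yw) (@lmul_new y (lmul x w)) ?descents_lmul //.
  apply/(same_trace_cons x); apply: same_trace_trans (same_trace_swap _ yx).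
  apply: (same_trace_trans (w2 := y :: w)).
    by apply/same_trace_sym/lmul_descent; rewrite -(lmul_new yw) descents_lmul.
  by apply/same_trace_cons/lmul_descent.
have [sw|sw] := boolP (s \in descents w);
  have [tw|tw] := boolP (t \in descents w).
- apply/(same_trace_cons s)/(same_trace_cons t).
  apply: (same_trace_trans (w2 := w)).
    apply: same_trace_sym; apply: same_trace_trans (lmul_descent tw) _.
    by apply/same_trace_cons/lmul_descent; rewrite dst.
  apply: same_trace_trans (same_trace_swap _ st).
  apply: same_trace_trans (lmul_descent sw) _.
  by apply/same_trace_cons/lmul_descent; rewrite dts.
- exact: new_descent.
- by apply: same_trace_sym; apply: new_descent.
- rewrite (@lmul_new s (lmul t w)) ?dst // (@lmul_new t (lmul s w)) ?dts //.
  by rewrite (lmul_new sw) (lmul_new tw); apply: same_trace_swap.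
Qed.

Lemma size_lmul_descent s w : s \in descents w -> size w = (size (lmul s w)).+1.
Proof. by move/lmul_descent/same_trace_size. Qed.

Lemma size_lmul s w : size (lmul s w) <= (size w).+1.
Proof.
have [sw|sw] := boolP (s \in descents w); last by rewrite lmul_new.
by rewrite (size_lmul_descent sw) ltnW.
Qed.

Definition act (u : seq Gamma) w : seq Gamma := foldr lmul w u.

Lemma same_trace_act u w1 w2 :
  same_trace w1 w2 -> same_trace (act u w1) (act u w2).
Proof. by move=> h; elim: u => //= s u IH; apply: same_trace_lmul. Qed.

Lemma reduced_act u w : reduced w -> reduced (act u w).
Proof. by move=> h; elim: u => //= s u IH; apply: reduced_lmul. Qed.

Lemma act_cat u v w : act (u ++ v) w = act u (act v w).
Proof. exact: foldr_cat. Qed.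

Lemma act_reduced w : reduced w -> act w [::] = w.
Proof. by elim: w => //= s w IH /andP[sw /IH ->]; rewrite lmul_new. Qed.

Lemma size_act_lt u : ~~ reduced u -> size (act u [::]) < size u.
Proof.
elim: u => //= s u IH; rewrite negb_and negbK ltnS.
have [ru|/IH lt_u _] := boolP (reduced u).
  by rewrite orbF act_reduced // => /size_lmul_descent ->.
exact: leq_trans (size_lmul _ _) lt_u.
Qed.

Lemma size_act u : size (act u [::]) <= size u.
Proof.
by have [/act_reduced ->|/size_act_lt/ltnW] := boolP (reduced u).
Qed.

(** The relations hold for the operators [lmul s] on reduced words up to
    commutation, so these operators define an action of the Coxeter group. Signs
    of letters are forgotten because the generators are involutions. *)
Lemma act_pres_equiv (u1 u2 : seq (Gamma * bool)) :
  pres_equiv (@racg_relator Gamma) u1 u2 ->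
  forall w, reduced w -> same_trace (act (unzip1 u1) w) (act (unzip1 u2) w).
Proof.
elim=> {u1 u2} [//|u1 u2 _ IH|u1 u2 u3 _ IH1 _ IH2|u v [s b]|u v r hr] w rw.
- exact/same_trace_sym/IH.
- exact: same_trace_trans (IH1 w rw) (IH2 w rw).
- rewrite /unzip1 !map_cat -!/unzip1 !act_cat /=.
  by apply/same_trace_act/lmulK/reduced_act.
- rewrite /unzip1 !map_cat -!/unzip1 !act_cat; apply: same_trace_act.
  have ra := reduced_act (unzip1 v) rw.
  case: hr => [s|s t st] /=; first exact: lmulK.
  set w' := act _ w in ra *.
  apply: (same_trace_trans (w2 := lmul s (lmul s (lmul t (lmul t w'))))).
    by apply/same_trace_lmul/lmul_comm; rewrite adj_sym.
  apply: same_trace_trans (lmulK _ _) (lmulK _ _) => //.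
  by do 2!apply: reduced_lmul.
Qed.

Definition positive w : seq (Gamma * bool) := [seq (s, false) | s <- w].

Lemma word_evalE w :
  word_eval (@racg_gen Gamma) w = pres_class (@racg_relator Gamma) (positive w).
Proof.
rewrite /word_eval; elim: w => [|s w IH]; first by rewrite big_nil.
by rewrite big_cons IH; apply: pres_mulE.
Qed.

(** Acting on the empty word gives a normal form of a group element, unique up to
    commutation; this solves the word problem. *)
Lemma same_trace_eval_act u v :
  word_eval (@racg_gen Gamma) u = word_eval (@racg_gen Gamma) v ->
  same_trace (act u [::]) (act v [::]).
Proof.
rewrite !word_evalE => /pres_classP/act_pres_equiv/(_ [::] isT).
by rewrite /positive /unzip1 -!map_comp !map_id.
Qed.

Lemma racg_gen2 s : (racg_gen s * racg_gen s = 1)%g.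
Proof.
rewrite -[LHS]/(pres_mul _ _) pres_mulE; apply/pres_classP.
exact: (pres_relator [::] [::] (racg_involution s)).
Qed.

Lemma racg_gen_comm s t :
  adj s t -> (racg_gen s * racg_gen t = racg_gen t * racg_gen s)%g.
Proof.
move=> st; have inv x : ((racg_gen x)^-1 = racg_gen x)%g.
  exact/mulg1_eq/racg_gen2.
rewrite -[RHS]invgK invgM !inv; apply/esym/mulg1_eq.
rewrite mulgA -[LHS]/(pres_mul (pres_mul (pres_mul _ _) _) _).
rewrite /racg_gen /pres_gen !pres_mulE.
by apply/pres_classP; exact: (pres_relator [::] [::] (racg_commute st)).
Qed.

Lemma word_eval_lmul s w :
  word_eval (@racg_gen Gamma) (lmul s w) =
  (racg_gen s * word_eval (@racg_gen Gamma) w)%g.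
Proof.
have eval_cons x v : word_eval (@racg_gen Gamma) (x :: v) =
    (racg_gen x * word_eval (@racg_gen Gamma) v)%g.
  by rewrite /word_eval big_cons.
have [sw|sw] := boolP (s \in descents w); last by rewrite lmul_new.
rewrite inE in sw; rewrite /lmul; case e: (extract s w) sw => [w'|] //= _.
elim: w w' e => //= x w IH w'; case: eqP => [-> [->]|_].
  by rewrite eval_cons mulgA racg_gen2 mul1g.
case: ifP => // sx; case e: (extract s w) => [w1|] //= [<-].
by rewrite !eval_cons mulgA racg_gen_comm // -mulgA (IH _ e).
Qed.

Lemma word_eval_act u :
  word_eval (@racg_gen Gamma) (act u [::]) = word_eval (@racg_gen Gamma) u.
Proof.
elim: u => //= s u IH; rewrite word_eval_lmul IH.
by rewrite /word_eval big_cons.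
Qed.

(** A reduced word is its own normal form, and normalization never lengthens a
    word, so no word for the same element is shorter. Conversely normalization
    strictly shortens a word that is not reduced. *)
Lemma geodesic_reduced w :
  (word_length (@racg_gen Gamma) (word_eval (@racg_gen Gamma) w) == size w) =
  reduced w.
Proof.
rewrite /word_length; case: pselect => [ex_word|[]]; last first.
  by exists (size w); apply/asboolP; exists w.
case: ex_minnP => n /asboolP[u <- eval_u] min_u; apply/eqP/idP => [size_u|rw].
  apply/negPn/negP=> /size_act_lt; apply/negP; rewrite -leqNgt -size_u.
  by apply: min_u; apply/asboolP; exists (act w [::]); rewrite ?word_eval_act.
apply/eqP; rewrite eqn_leq min_u; last by apply/asboolP; exists w.
rewrite -{1}(act_reduced rw).
by rewrite -(same_trace_size (same_trace_eval_act eval_u)) size_act.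
Qed.

End Traces.

(** * The automaton of geodesics *)

Section Automaton.
Variable Gamma : sgraph.
Implicit Types (v x : Gamma) (sigma tau : {set Gamma}) (w : seq Gamma).

Definition neighbours v : {set Gamma} := [set x | adj v x].

(** The descents of [v :: w] are [v] and the descents of [w] that commute with
    [v]. *)
Definition step sigma v : {set Gamma} := v |: sigma :&: neighbours v.

Fixpoint accepts sigma w : bool :=
  if w is v :: w' then (v \notin sigma) && accepts (step sigma v) w' else true.

Fixpoint runs n sigma : nat :=
  if n is n'.+1 then \sum_(v | v \notin sigma) runs n' (step sigma v) else 1.

Lemma descents_step v w : descents (v :: w) = step (descents w) v.
Proof.
by apply/setP=> x; rewrite in_descents_cons !(in_setU1, in_setI) (in_set (adj v)).
Qed.

Lemma reduced_catrev u w : reduced (catrev u w) -> reduced w.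
Proof. by elim: u w => //= v u IH w /IH /andP[]. Qed.

(** Descents are read off at the front of a word while letters are added there,
    so the automaton reads reduced words from right to left; [catrev] records the
    reversal. *)
Lemma reduced_accepts u w :
  reduced w -> reduced (catrev u w) = accepts (descents w) u.
Proof.
elim: u w => //= v u IH w rw; have [vw|vw] := boolP (v \in descents w).
  by apply/negP => /reduced_catrev /=; rewrite vw.
by rewrite IH /= ?vw // descents_step.
Qed.

Lemma card_accepts n sigma :
  #|[set w : n.-tuple Gamma | accepts sigma w]| = runs n sigma.
Proof.
elim: n sigma => [|n IH] sigma /=.
  rewrite (_ : [set _ | _] = setT) ?cardsT ?card_tuple ?expn0 //.
  by apply/setP=> w; rewrite !inE tuple0.
under eq_bigr do rewrite -IH -sum1_card.
rewrite pair_big_dep -sum1_card /=.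
rewrite (reindex (fun p : Gamma * n.-tuple Gamma => cons_tuple p.1 p.2)) /=.
  by apply: eq_bigl => p; rewrite !inE.
exists (fun w : n.+1.-tuple Gamma => (thead w, behead_tuple w)) => [[v w] _|w _] /=.
  by congr (_, _); apply: val_inj.
by apply: val_inj; rewrite /= [in RHS](tuple_eta w).
Qed.

Lemma geodesic_growth_runs r :
  geodesic_growth (@racg_gen Gamma) r = runs r set0.
Proof.
rewrite -card_accepts -[RHS](on_card_preimset (f := @rev_tuple r Gamma)).
  apply: eq_card => w; rewrite !inE -[X in _ == X](size_tuple w) geodesic_reduced.
  rewrite -[in LHS](revK w) /= {1}/rev reduced_accepts //.
by apply: onW_bij; exists (@rev_tuple r Gamma) => w; apply: val_inj; rewrite /= revK.
Qed.

End Automaton.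

(** * Sums determined by binomial moments *)

(** Expanding at ['X + 1] turns the monomial ['X^n] into the polynomial whose
    coefficients are the binomials ['C(n, i)]. *)
Lemma coef_XD1_exp (R : comNzRingType) n i :
  ((('X + 1 : {poly R}) ^+ n)`_i = 'C(n, i)%:R)%R.
Proof.
elim: n i => [|n IH] i; first by rewrite expr0 coef1 bin0n.
rewrite exprSr mulrDr mulr1 coefD coefMX !IH.
by case: i => [|i]; rewrite ?bin0 ?add0r // binS natrD addrC.
Qed.

Lemma eq_sum_const (T1 T2 : finType) (P1 : pred T1) (P2 : pred T2)
    (F1 : T1 -> nat) (F2 : T2 -> nat) :
  #|P1| = #|P2| -> (forall x y, P1 x -> P2 y -> F1 x = F2 y) ->
  \sum_(x | P1 x) F1 x = \sum_(y | P2 y) F2 y.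
Proof.
move=> cardP eqF; case: (pickP P1) => [x0 P1x0|P1_0]; last first.
  rewrite big_pred0 // big_pred0 //; apply/card0_eq.
  by rewrite -cardP; apply: eq_card0.
case: (pickP P2) => [y0 P2y0|P2_0]; last first.
  have := card0_eq (etrans cardP (eq_card0 P2_0)) x0.
  by rewrite unfold_in P1x0.
rewrite (eq_bigr (fun=> F2 y0)) => [|x P1x]; last exact: eqF.
rewrite [RHS](eq_bigr (fun=> F2 y0)) => [|y P2y]; last first.
  by rewrite -(eqF x0 y) // (eqF x0 y0).
by rewrite !sum_nat_const cardP.
Qed.

Section BinomialMoments.
Variables (T1 T2 : finType) (P1 : pred T1) (P2 : pred T2).
Variables (a1 : T1 -> nat) (a2 : T2 -> nat).
Hypothesis eq_binomial_moments :
  forall i, \sum_(x | P1 x) 'C(a1 x, i) = \sum_(y | P2 y) 'C(a2 y, i).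

(** The binomial moments are the coefficients of the generating function
    [\sum_x 'X^(a x)] after the substitution of ['X + 1] for ['X]; this
    substitution is invertible, and the coefficients of the generating function
    itself are the sizes of the fibres. *)
Lemma eq_fibers d :
  #|[pred x | P1 x & a1 x == d]| = #|[pred y | P2 y & a2 y == d]|.
Proof.
pose gf (T : finType) (P : pred T) (a : T -> nat) : {poly int} :=
  (\sum_(x | P x) 'X^(a x))%R.
have coef_gf (T : finType) (P : pred T) a :
    ((gf T P a)`_d)%R = #|[pred x | P x & a x == d]|%:R%R.
  rewrite coef_sum -sum1_card natr_sum (bigID [pred x | a x == d]) /=.
  rewrite addrC big1 ?add0r => [|x /andP[_ /negPf adx]]; last first.
    by rewrite coefXn eq_sym adx.
  by apply: eq_bigr => x /andP[_ /eqP->]; rewrite coefXn eqxx.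
have shift_gf (T : finType) (P : pred T) a i :
    ((gf T P a \Po ('X + 1%:P))`_i)%R = (\sum_(x | P x) 'C(a x, i))%:R%R.
  rewrite raddf_sum coef_sum natr_sum; apply: eq_bigr => x _.
  by rewrite /= comp_Xn_poly coef_XD1_exp.
suff eq_gf : gf T1 P1 a1 = gf T2 P2 a2.
  by have := coef_gf T1 P1 a1; rewrite eq_gf coef_gf => /eqP; rewrite eqr_nat => /eqP.
rewrite -[LHS](comp_polyXaddC_K _ 1%R) -[RHS](comp_polyXaddC_K _ 1%R).
by congr (_ \Po _)%R; apply/polyP=> i; rewrite !shift_gf eq_binomial_moments.
Qed.

(** Both sums are grouped by the values of [a1] and [a2]: corresponding fibres
    have the same size, and on them the summands agree and are constant. *)
Lemma eq_sum_binomial (F1 : T1 -> nat) (F2 : T2 -> nat) :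
  (forall x y, P1 x -> P2 y -> a1 x = a2 y -> F1 x = F2 y) ->
  \sum_(x | P1 x) F1 x = \sum_(y | P2 y) F2 y.
Proof.
move=> eqF; pose N := maxn (\max_x a1 x) (\max_y a2 y).
have a1N x : a1 x < N.+1 by rewrite ltnS leq_max leq_bigmax.
have a2N y : a2 y < N.+1 by rewrite ltnS leq_max orbC leq_bigmax.
rewrite (partition_big (fun x => Ordinal (a1N x)) predT) //.
rewrite [RHS](partition_big (fun y => Ordinal (a2N y)) predT) //.
apply: eq_bigr => d _.
under eq_bigl do rewrite -val_eqE; under [RHS]eq_bigl do rewrite -val_eqE.
apply: eq_sum_const; first exact: eq_fibers.
move=> x y /andP[P1x /eqP ax] /andP[P2y /eqP ay].
by apply: eqF => //; exact: etrans ax (esym ay).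
Qed.

End BinomialMoments.

(** * Transitions out of a clique *)

Section Transitions.
Variable Gamma : sgraph.
Implicit Types (v x : Gamma) (sigma tau : {set Gamma}).

(** Unlike a clique, a complete set may be empty: the initial state of the
    automaton is the empty set of descents. *)
Definition complete sigma : bool :=
  [forall x in sigma, forall y in sigma, (x != y) ==> adj x y].

Lemma completeP sigma :
  reflect {in sigma &, forall x y, x != y -> adj x y} (complete sigma).
Proof.
apply: (iffP 'forall_in_forall_inP) => h x y.
  by move=> xs ys; apply/implyP/h.
by move=> xs ys; apply/implyP/h.
Qed.

Lemma complete_sub tau sigma : tau \subset sigma -> complete sigma -> complete tau.
Proof.
move/subsetP=> sub /completeP h; apply/completeP=> x y /sub xs /sub ys.
exact: h.
Qed.

Lemma complete_step sigma v : complete sigma -> complete (step sigma v).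
Proof.
move/completeP=> h; apply/completeP=> x y; rewrite !inE.
case/orP=> [/eqP ->|/andP[xs vx]]; case/orP=> [/eqP ->|/andP[ys vy]] //.
- by rewrite eqxx.
- by rewrite adj_sym.
- exact: h.
Qed.

Lemma card_step sigma v : #|step sigma v| = #|sigma :&: neighbours v|.+1.
Proof. by rewrite cardsU1 !inE adj_irr andbF. Qed.

(** For [tau = set0] this makes the link the whole vertex set. *)
Lemma in_link tau v :
  complete tau -> (v \in link tau) = (tau \subset neighbours v).
Proof.
move=> /completeP h; rewrite !inE /is_clique -/(complete _).
apply/idP/subsetP=> [/and3P[vt _ /completeP c] x xt|sub].
  rewrite inE; apply: c; rewrite ?setU11 ?setU1r //.
  by apply: contraNneq vt => ->.
have adjv x : x \in tau -> adj v x by move/sub; rewrite inE.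
have vt : v \notin tau by apply/negP=> /adjv; rewrite adj_irr.
rewrite vt /=; apply/andP; split; first by apply/set0Pn; exists v; rewrite setU11.
apply/completeP=> x y /setU1P[->|xt] /setU1P[->|yt] //.
- by rewrite eqxx.
- by rewrite adjv.
- by rewrite adj_sym adjv.
- exact: h.
Qed.

(** The vertices of [sigma :\: tau] all lie in the link of [tau], because
    [sigma] is complete. *)
Lemma card_link_outside sigma tau :
  complete sigma -> tau \subset sigma ->
  #|link tau :\: sigma| = #|link tau| - (#|sigma| - #|tau|).
Proof.
move=> cs ts; rewrite cardsD; congr (_ - _).
rewrite -{2}(setIidPr ts) -cardsD; apply: eq_card => x; rewrite in_setI in_setD.
have [xs|xs] := boolP (x \in sigma); last by rewrite !andbF.
rewrite !andbT in_link ?(complete_sub ts) //.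
apply/subsetP/idP => [sub|xt y yt].
  by apply/negP=> /sub; rewrite inE adj_irr.
rewrite inE; apply: (completeP _ cs) => //; first exact: (subsetP ts).
by apply: contraNneq xt => ->.
Qed.

(** Double counting of the pairs of a vertex [v] outside [sigma] and an
    [i]-element subset [tau] of [sigma] all of whose vertices are adjacent to [v].
    The right-hand side depends only on the sizes of [sigma] and of the links of
    its faces. *)
Lemma binomial_moments sigma i :
  complete sigma ->
  \sum_(v | v \notin sigma) 'C(#|sigma :&: neighbours v|, i) =
  \sum_(tau : {set Gamma} | (tau \subset sigma) && (#|tau| == i))
     (#|link tau| - (#|sigma| - i)).
Proof.
move=> cs.
under eq_bigr do rewrite -cards_draws -sum1_card.
rewrite (exchange_big_dep (fun tau : {set Gamma} => (tau \subset sigma) && (#|tau| == i))) /=.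
  apply: eq_bigr => tau /andP[ts /eqP ti].
  rewrite -ti -card_link_outside // -[RHS]sum1_card; apply: eq_bigl => v.
  by rewrite in_setD (in_link _ (complete_sub ts cs)) inE subsetI ts ti eqxx andbT.
by move=> v tau _; rewrite inE subsetI -andbA => /and3P[-> _ ->].
Qed.

Lemma fnum0 : fnum Gamma 0 = #|Gamma|.
Proof.
rewrite /fnum -(card_imset predT (@set1_inj Gamma)).
apply: eq_card => sigma; rewrite !inE; apply/andP/imsetP.
  by case=> _ /cards1P[x ->]; exists x.
case=> x _ ->; rewrite cards1 eqxx; split=> //; apply/andP; split.
  by apply/set0Pn; exists x; rewrite set11.
by apply/completeP=> y z /set1P -> /set1P ->; rewrite eqxx.
Qed.

(** Supplies the size of the link of the empty set, which is not a clique. *)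
Lemma fpoly_coef1 : ((fpoly Gamma)`_1 = #|Gamma|%:R)%R.
Proof.
rewrite /fpoly coefD coef1 add0r coef_sum -[in RHS]fnum0.
case e: #|Gamma| => [|n]; first by rewrite big_ord0 fnum0 e.
rewrite big_ord_recl big1 ?addr0 => [|j _]; rewrite coefZ coefXn ?mulr1 //.
by rewrite mulr0.
Qed.

End Transitions.

(** * Equality of the growth series *)

Theorem corollary3p8 (Gamma1 Gamma2 : sgraph)
  (same_fpoly : fpoly Gamma1 = fpoly Gamma2)
  (same_links : forall (sigma : {set Gamma1}) (sigma' : {set Gamma2}),
     sigma \in cliques Gamma1 -> sigma' \in cliques Gamma2 ->
     #|sigma| = #|sigma'| -> #|link sigma| = #|link sigma'|) :
  geodesic_growth_series (@racg_gen Gamma1) =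
  geodesic_growth_series (@racg_gen Gamma2).
Proof.
have same_card : #|Gamma1| = #|Gamma2|.
  have := fpoly_coef1 Gamma1; rewrite same_fpoly fpoly_coef1.
  by move/eqP; rewrite eqr_nat => /eqP.
have card_link0 (Gamma : sgraph) : #|link (set0 : {set Gamma})| = #|Gamma|.
  rewrite -cardsT; congr #|pred_of_set _|; apply/setP=> v.
  rewrite in_link ?sub0set ?inE //; by apply/completeP=> x y; rewrite inE.
have same_link (tau1 : {set Gamma1}) (tau2 : {set Gamma2}) :
    complete tau1 -> complete tau2 -> #|tau1| = #|tau2| ->
    #|link tau1| = #|link tau2|.
  have [->|ne1] := eqVneq tau1 set0 => c1 c2.
    by rewrite cards0 => /esym/cards0_eq ->; rewrite !card_link0.
  move=> e; apply: same_links => //; rewrite inE; apply/andP; split=> //.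
  by rewrite -card_gt0 -e card_gt0.
suff same_runs n (sigma1 : {set Gamma1}) (sigma2 : {set Gamma2}) :
    complete sigma1 -> complete sigma2 -> #|sigma1| = #|sigma2| ->
    runs n sigma1 = runs n sigma2.
  apply: functional_extensionality_dep => r; rewrite /geodesic_growth_series.
  rewrite !geodesic_growth_runs; congr (_%:Z)%R; apply: same_runs.
  - by apply/completeP=> x y; rewrite inE.
  - by apply/completeP=> x y; rewrite inE.
  - by rewrite !cards0.
(* The transitions from two complete sets of the same size have the same
   binomial moments, so they can be matched with equal sizes of target. *)
elim: n sigma1 sigma2 => //= n IH sigma1 sigma2 c1 c2 e.
apply: (@eq_sum_binomial _ _ _ _
  (fun v => #|sigma1 :&: neighbours v|) (fun v => #|sigma2 :&: neighbours v|)).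
  move=> i; rewrite !binomial_moments //; apply: eq_sum_const.
    by rewrite -[LHS]cardsE -[RHS]cardsE !cards_draws e.
  move=> tau1 tau2 /andP[s1 /eqP t1] /andP[s2 /eqP t2]; rewrite e.
  by congr (_ - _); apply: same_link; rewrite ?t1 ?t2 //;
     [apply: complete_sub c1 | apply: complete_sub c2].
move=> v1 v2 _ _ d; apply: IH; rewrite ?complete_step //.
by rewrite !card_step d.
Qed.
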